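(* For the family of swap dynamics $\mathcal{M}_2$, the price of dynamics with respect to the minimum rank, $\mathit{PoD}_{mrk}(\mathcal{M}_2)$, is $\Theta(n)$ in the single-peaked domain, where $n$ is the number of agents.
   Context: Housing market: an instance is $I=\langle \mathcal{N},\mathcal{R},L,\pi^0\rangle$ with $\mathcal{N}=\{a_1,\dots,a_n\}$ a set of $n$ agents, $\mathcal{R}=\{r_1,\dots,r_n\}$ a set of $n$ resources, $L$ a profile of strict linear orders $\succ_i$ over $\mathcal{R}$, one for each agent $a_i$, and $\pi^0$ an initial allocation; an allocation $\pi$ is a bijective assignment of one resource $\pi_{a_i}$ to each agent $a_i$. The instance is single-peaked if there is a linear order $\lhd$ over $\mathcal{R}$ such that for every agent $a_i$ with top resource $t_i$ and all resources $r,r'$, if $r'\lhd r\lhd t_i$ or $t_i\lhd r\lhd r'$ then $r\succ_i r'$. Ranks: $rank_{a_i}(r)\in\{1,\dots,n\}$ is such that $a_i$'s most preferred resource has rank $n$, the second most preferred $n-1$, ..., the least preferred $1$. The minimum rank is $mrk(\pi)=\min_{a_i\in\mathcal{N}}rank_{a_i}(\pi_{a_i})$. Swap dynamics: a swap-deal between two distinct agents exchanges the resources they currently hold; it is improving if both strictly prefer the resource they receive. A swap dynamics is determined by a selection heuristic, which at each round proposes a swap-deal (a pair of agents), possibly depending on the history and on the preferences, possibly randomly. Starting from $\pi^0$, the proposed deal is implemented (successful) if it is improving and refused otherwise. The heuristic has full coverage if for any two agents $a_x,a_y$ the deal $\langle a_x,a_y\rangle$ is proposed at some round, and, if there are successful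 swap-deals involving $a_x$ or $a_y$, at some round after the latest one. The process terminates when every pair $a_x,a_y$ has been unsuccessfully proposed at a round after which no successful deal involved $a_x$ or $a_y$; thus the final allocation is reached from $\pi^0$ by improving swap-deals and admits no improving swap-deal. $\mathcal{M}_2$ is the family of all swap dynamics whose selection heuristic has full coverage. $M(I)$ is the (nonempty) set of allocations that $M$ may return on $I$. Price of dynamics: $\mathit{PoD}_{mrk}(\mathcal{M}_2)=\max_{I,\;M,M'\in\mathcal{M}_2}\dfrac{\max_{\pi\in M'(I)}mrk(\pi)}{\min_{\pi\in M(I)}mrk(\pi)}$, viewed as a function of $n$, where $I$ ranges over the single-peaked instances with $n$ agents. *)

(* Defs.v *)
From HB Require Import structures.
From mathcomp Require Import all_boot all_order all_algebra all_fingroup.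
From mathcomp Require Import all_classical all_reals all_analysis.

Set Implicit Arguments.
Unset Strict Implicit.
Unset Printing Implicit Defensive.

Import Order.TTheory GRing.Theory Num.Theory.
Import numFieldNormedType.Exports.

Local Open Scope nat_scope.

Definition strict_linear_order (T : eqType) (r : rel T) : Prop :=
  [/\ irreflexive r, transitive r & forall x y, x != y -> r x y || r y x].

(* Agents and resources are both numbered by 'I_n.  There are at least two
   agents, since otherwise there is no swap-deal for a heuristic to propose. *)
Record instance (n : nat) := Instance {
  prefers : 'I_n -> rel 'I_n;
  initial : 'S_n;
  prefersP : forall i, strict_linear_order (prefers i);
  instance_gt1 : 1 < n
}.

Definition is_top n (I : instance n) (i t : 'I_n) : Prop :=
  forall r, r != t -> prefers I i t r.

Definition single_peaked n (I : instance n) : Prop :=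
  exists2 axis : rel 'I_n, strict_linear_order axis &
    forall i t r r', is_top I i t ->
      (axis r' r && axis r t) || (axis t r && axis r r') ->
      prefers I i r r'.

Definition rank n (I : instance n) (i r : 'I_n) : nat :=
  #|[pred r' | prefers I i r r']|.+1.

(* The neutral element n is an upper bound of all ranks. *)
Definition mrk n (I : instance n) (pi : 'S_n) : nat :=
  \big[minn/n]_(i < n) rank I i (pi i).

Definition deal (n : nat) := {d : 'I_n * 'I_n | d.1 != d.2}.

(* The two components of a deal play the same role: deals are compared through
   this unordered pair. *)
Definition parties n (d : deal n) : {set 'I_n} :=
  ([set (val d).1; (val d).2])%SET.

Definition improving n (I : instance n) (pi : 'S_n) (d : deal n) : bool :=
  let: (x, y) := val d in
  prefers I x (pi y) (pi x) && prefers I y (pi x) (pi y).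

Definition swap n (pi : 'S_n) (d : deal n) : 'S_n :=
  (tperm (val d).1 (val d).2 * pi)%g.

Definition propose n (I : instance n) (pi : 'S_n) (d : deal n) : 'S_n :=
  if improving I pi d then swap pi d else pi.

(* A deterministic heuristic chooses the next deal from the instance and from
   the chronological list of the deals proposed so far; together with the
   instance, this list determines which of them succeeded. *)
Definition heuristic := forall n : nat, instance n -> seq (deal n) -> deal n.

Section Run.
Variables (s : heuristic) (n : nat) (I : instance n).

Fixpoint history (t : nat) : seq (deal n) :=
  if t is t'.+1 then rcons (history t') (s I (history t')) else [::].

Definition proposal (t : nat) : deal n := s I (history t).

Definition alloc (t : nat) : 'S_n := foldl (propose I) (initial I) (history t).

Definition proposed_at (x y : 'I_n) (t : nat) : Prop :=
  parties (proposal t) = ([set x; y])%SET.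

Definition success_at (t : nat) : bool := improving I (alloc t) (proposal t).

Definition success_involving (x y : 'I_n) (t : nat) : Prop :=
  success_at t /\
  (x \in parties (proposal t)) || (y \in parties (proposal t)).

Definition covers : Prop :=
  forall x y : 'I_n, x != y ->
    (exists t, proposed_at x y t) /\
    (forall u, success_involving x y u ->
       (forall v, u < v -> ~ success_involving x y v) ->
       exists2 t, u < t & proposed_at x y t).

(* alloc t is the allocation after the rounds 0, ..., t - 1. *)
Definition terminated (t : nat) : Prop :=
  forall x y : 'I_n, x != y ->
    exists u, [/\ u < t, proposed_at x y u, ~~ success_at u &
      forall v, u < v < t -> ~ success_involving x y v].

(* No deal is improving from the first terminated round on, so alloc t is the
   same at all terminated rounds. *)
Definition returns (pi : 'S_n) : Prop :=
  exists2 t, terminated t & alloc t = pi.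

End Run.

(* A randomized heuristic is a random variable with values in the
   deterministic heuristics. *)
Record dynamics (R : realType) := Dynamics {
  dyn_disp : measure_display;
  dyn_space : measurableType dyn_disp;
  dyn_prob : probability dyn_space R;
  dyn_select : dyn_space -> heuristic;
  dyn_measurable : forall n (I : instance n) (h : seq (deal n)) (d : deal n),
    measurable [set w | dyn_select w I h = d]%classic
}.

(* Full coverage is almost sure: for instance, drawing a deal uniformly at
   random at every round qualifies. *)
Definition M2 (R : realType) (M : dynamics R) : Prop :=
  forall n (I : instance n),
    {ae dyn_prob M, forall w, covers (dyn_select w) I}.

Definition outcomes (R : realType) (M : dynamics R) n (I : instance n) :
    set 'S_n :=
  [set pi | (0 < dyn_prob M [set w | returns (dyn_select w) I pi])%E]%classic.

Definition best_mrk (R : realType) (M : dynamics R) n (I : instance n) : nat :=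
  \max_(pi : 'S_n | pi \in outcomes M I) mrk I pi.

Definition worst_mrk (R : realType) (M : dynamics R) n (I : instance n) : nat :=
  \big[minn/n]_(pi : 'S_n | pi \in outcomes M I) mrk I pi.

(* The ratios are quotients of integers in {1, ..., n}, so there are finitely
   many of them and the supremum is a maximum (for n >= 2). *)
Definition PoD_mrk_M2 (R : realType) (n : nat) : R :=
  sup [set q : R | exists (I : instance n) (M M' : dynamics R),
    [/\ single_peaked I, M2 M, M2 M' &
        q = ((best_mrk M' I)%:R / (worst_mrk M I)%:R)%R]]%classic.

(* Main.v *)
(* Ranks lie in {1, ..., n}, so every ratio is at most n.  For the converse,
   take resources 0, ..., n - 1 along the axis, every agent i starting with
   resource i, and the preferences
     agent 0 : 2 > 3 > ... > n - 1 > 1 > 0        agent 1 : 2 > 1 > 0 > 3 > ...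
     agent 2 : 1 > 0 > 2 > 3 > ...                agent i >= 3 : i first.
   If agents 0 and 2 swap first, nobody does worse than a second choice and no
   improving deal is left.  If agents 1 and 2 swap first, everybody but agent 0
   gets a first choice, so agent 0 is stuck with a last choice.  Both deals can
   be forced as the first one before a round-robin takes over, and the ratio is
   n - 1. *)

Require Import Defs.
From mathcomp Require Import all_boot all_order all_algebra.
From mathcomp Require Import all_classical all_reals all_analysis.
From mathcomp Require Import all_fingroup zify.
Import numFieldNormedType.Exports.
Import Order.TTheory GRing.Theory Num.Theory.
Local Open Scope classical_set_scope.
Local Open Scope ring_scope.

Set Implicit Arguments.
Unset Strict Implicit.
Unset Printing Implicit Defensive.

(** * Ranks and ratios *)

Lemma bigminn_leq (T : eqType) (n : nat) (s : seq T) (P : pred T)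
    (F : T -> nat) (x : T) :
  x \in s -> P x -> (\big[minn/n]_(i <- s | P i) F i <= F x)%N.
Proof.
elim: s => // y s IH; rewrite inE big_cons => /predU1P[<- -> | xs Px].
  exact: geq_minl.
case: (P y); last exact: IH.
by apply: leq_trans (IH xs Px); apply: geq_minr.
Qed.

Lemma rank_leq n (I : instance n) (i r : 'I_n) : (rank I i r <= n)%N.
Proof.
have [irr _ _] := prefersP I i.
rewrite /rank -[X in (_ <= X)%N]card_ord; apply: proper_card.
apply/properP; split; first exact: subset_predT.
by exists r; rewrite // inE irr.
Qed.

Lemma mrk_gt0 n (I : instance n) (pi : 'S_n) : (0 < mrk I pi)%N.
Proof.
rewrite /mrk; elim/big_ind: _ => //; first exact: ltnW (instance_gt1 I).
by move=> x y; rewrite leq_min => -> ->.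
Qed.

Lemma mrk_leq_rank n (I : instance n) (pi : 'S_n) (i : 'I_n) :
  (mrk I pi <= rank I i (pi i))%N.
Proof.
apply: (@bigminn_leq _ _ _ _ (fun i => rank I i (pi i))) => //.
exact: mem_index_enum.
Qed.

Lemma mrk_leq n (I : instance n) (pi : 'S_n) : (mrk I pi <= n)%N.
Proof.
pose i0 : 'I_n := Ordinal (ltnW (instance_gt1 I)).
exact: leq_trans (mrk_leq_rank I pi i0) (rank_leq I i0 (pi i0)).
Qed.

Lemma leq_mrk n (I : instance n) (pi : 'S_n) (k : nat) :
  (k <= n)%N -> (forall i, k <= rank I i (pi i))%N -> (k <= mrk I pi)%N.
Proof.
move=> kn kr; rewrite /mrk; elim/big_ind: _ => // x y.
by rewrite leq_min => -> ->.
Qed.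

Lemma worst_mrk_gt0 (R : realType) (M : dynamics R) n (I : instance n) :
  (0 < worst_mrk M I)%N.
Proof.
rewrite /worst_mrk; elim/big_ind: _ => [|x y|pi _].
- exact: ltnW (instance_gt1 I).
- by rewrite leq_min => -> ->.
- exact: mrk_gt0.
Qed.

Lemma best_mrk_leq (R : realType) (M : dynamics R) n (I : instance n) :
  (best_mrk M I <= n)%N.
Proof. by apply/bigmax_leqP => pi _; exact: mrk_leq. Qed.

Lemma ratio_leq (R : realType) (M M' : dynamics R) n (I : instance n) :
  (best_mrk M' I)%:R / (worst_mrk M I)%:R <= n%:R :> R.
Proof.
rewrite ler_pdivrMr ?ltr0n ?worst_mrk_gt0 // -natrM ler_nat.
by rewrite (leq_trans (best_mrk_leq M' I)) // leq_pmulr ?worst_mrk_gt0.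
Qed.

(** * Deterministic dynamics with a prescribed first deal *)

Definition stable n (I : instance n) (pi : 'S_n) : Prop :=
  forall d, ~~ improving I pi d.

Section RoundRobin.
Variable f : forall n, instance n -> deal n.

(** Prepending [f I] to the list of all deals, where it occurs once more, makes it the opening deal
    of every cycle. The length of the history serves as the round number. *)
Definition round_robin : heuristic := fun n I h =>
  nth (f I) (f I :: enum {: deal n}) (size h %% #|{: deal n}|.+1).

Variables (n : nat) (I : instance n).

Lemma size_history t : size (history round_robin I t) = t.
Proof. by elim: t => //= t IH; rewrite size_rcons IH. Qed.

(** The upper bound does not depend on [d], so one round works for all deals when termination is
    shown. *)
Lemma round_robin_proposes (d : deal n) (u : nat) :
  exists t, (u < t <= u.+2 * #|{: deal n}|.+1)%N /\
            proposal round_robin I t = d.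
Proof.
have ltd : (index d (f I :: enum {: deal n}) < #|{: deal n}|.+1)%N.
  by rewrite cardE -/(size (f I :: _)) index_mem inE mem_enum orbT.
(* Cycle [u.+1] starts after round [u], since a cycle has at least one round. *)
exists (index d (f I :: enum {: deal n}) + u.+1 * #|{: deal n}|.+1)%N.
split; first by move: ltd; nia.
rewrite /proposal /round_robin size_history addnC modnMDl modn_small //.
by rewrite nth_index // inE mem_enum orbT.
Qed.

Lemma round_robin_covers : covers round_robin I.
Proof.
move=> x y xy; pose d : deal n := Sub (x, y) xy.
have E t : proposal round_robin I t = d -> proposed_at round_robin I x y t.
  by rewrite /proposed_at => ->.
split=> [|u _ _].
  by have [t [_ /E]] := round_robin_proposes d 0; exists t.
by have [t [/andP[ut _] /E]] := round_robin_proposes d u; exists t.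
Qed.

(** No proposal after the first can change the stable allocation, so a later full cycle of refusals
    ends the process. *)
Lemma round_robin_returns :
  improving I (initial I) (f I) -> stable I (swap (initial I) (f I)) ->
  returns round_robin I (swap (initial I) (f I)).
Proof.
move=> imp stab.
have allocS t : alloc round_robin I t.+1 = swap (initial I) (f I).
  elim: t => [|t IH].
    by rewrite /alloc /= -[round_robin I [::]]/(f I) /propose imp.
  rewrite /alloc /= foldl_rcons -/(alloc round_robin I t.+1) IH /propose.
  by rewrite (negbTE (stab _)).
have fail t : (0 < t)%N -> ~~ success_at round_robin I t.
  by case: t => // t _; rewrite /success_at allocS.
(* This is the bound of [round_robin_proposes] at [u = 0], plus one because [terminated] asks for
   strictly earlier rounds. *)
exists (2 * #|{: deal n}|.+1).+1 => // x y xy.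
pose d : deal n := Sub (x, y) xy.
have [u [/andP[u0 ule] ud]] := round_robin_proposes d 0.
exists u; split; rewrite ?ltnS //.
- by rewrite /proposed_at ud.
- exact: fail.
move=> v /andP[uv _] [sv _].
by have := fail v (ltn_trans u0 uv); rewrite sv.
Qed.

End RoundRobin.

Lemma default_deal_subproof n (I : instance n) :
  Ordinal (ltnW (instance_gt1 I)) != Ordinal (instance_gt1 I).
Proof. by []. Qed.

(* A heuristic is defined for all n, even when a or b is not an agent: hence the
   default deal. *)
Definition opening (a b : nat) n (I : instance n) : deal n :=
  odflt (exist _ (_, _) (default_deal_subproof I))
    [pick d : deal n | ((val d).1 == a :> nat) && ((val d).2 == b :> nat)].

Lemma openingE n (I : instance n) (d : deal n) :
  opening (val d).1 (val d).2 I = d.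
Proof.
rewrite /opening; case: pickP => [d' /andP[/eqP e1 /eqP e2]|/(_ d)]; last first.
  by rewrite !eqxx.
case: d d' e1 e2 => [[x y] xy] [[x' y'] xy'] /= /val_inj ex /val_inj ey.
by apply: val_inj; rewrite /= ex ey.
Qed.

Section Deterministic.
Variables (R : realType) (s : heuristic).

Lemma deterministic_measurable n (I : instance n) (h : seq (deal n))
    (d : deal n) : measurable [set w : unit | s I h = d].
Proof. by []. Qed.

Definition deterministic : dynamics R :=
  @Dynamics R _ unit (dirac tt) (fun _ => s) deterministic_measurable.

Lemma deterministic_M2 :
  (forall n (I : instance n), covers s I) -> M2 deterministic.
Proof. by move=> cs n I; apply: aeW => w; exact: cs. Qed.

Lemma deterministic_outcomes n (I : instance n) (pi : 'S_n) :
  returns s I pi -> pi \in outcomes deterministic I.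
Proof.
move=> rs; rewrite in_setE /outcomes /=.
have -> : [set w : unit | returns s I pi] = setT by apply/seteqP; split.
by rewrite diracT.
Qed.

End Deterministic.

(** * Preferences given by cost functions *)

Section Cost.
Variables (n : nat) (n_gt1 : (1 < n)%N) (cost : 'I_n -> 'I_n -> nat).
Hypothesis cost_inj : forall i, injective (cost i).

Lemma cost_strict i : strict_linear_order [rel r r' | (cost i r < cost i r')%N].
Proof.
split=> [r|r' r r''|r r' neq] /=; [exact: ltnn | exact: ltn_trans |].
by rewrite -neq_ltn (inj_eq (@cost_inj i)).
Qed.

Definition cost_instance : instance n :=
  Instance 1%g cost_strict n_gt1.

(** By injectivity at most [cost i r + 1] resources cost no more than [r]; all the others are ranked
    below it. *)
Lemma rank_cost i r : (n - cost i r <= rank cost_instance i r)%N.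
Proof.
pose A : pred 'I_n := [pred r' | (cost i r < cost i r')%N].
suff: (#|[predC A]| <= (cost i r).+1)%N.
  have := cardC A; rewrite card_ord => cA Ac.
  change (n - cost i r <= #|A|.+1)%N.
  by rewrite leq_subLR addnS -addSn addnC -[leqLHS]cA leq_add2l.
rewrite cardE -(size_map (cost i)) -[leqRHS](size_iota 0).
apply: uniq_leq_size; first by rewrite (map_inj_uniq (@cost_inj i)) enum_uniq.
by move=> _ /mapP[r' + ->]; rewrite mem_enum mem_iota add0n ltnS inE -leqNgt.
Qed.

(** An agent holding a resource of cost 0 has a first choice and refuses every swap. *)
Lemma not_improving_cost (pi : 'S_n) (d : deal n) :
    (cost (val d).1 (pi (val d).1) == 0)%N
      || (cost (val d).2 (pi (val d).2) == 0)%N ->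
  ~~ improving cost_instance pi d.
Proof.
rewrite /improving; case: (val d) => x y /=.
by case/orP => /eqP ->; rewrite /= ?andbF.
Qed.

End Cost.

(** * The lower bound instance *)

(* Position of r in the single-peaked order with peak t where all resources left
   of t precede those right of t (left_first), or conversely (right_first). *)
Definition left_first (t r : nat) : nat := if (r <= t)%N then (t - r)%N else r.

Definition right_first (n t r : nat) : nat :=
  if (t <= r)%N then (r - t)%N else (n - r.+1)%N.

(** For [m.+3] agents, the cost is the position of [r] in the preference list of agent [i], counted
    from 0. *)
Definition gap_cost (m i r : nat) : nat :=
  match i with
  | 0 => right_first m.+3 2 r
  | 1 => left_first 2 r
  | 2 => left_first 1 r
  | _ => left_first i r
  end.

Section Gap.
Variable m : nat.

Let cost (i r : 'I_m.+3) : nat := gap_cost m i r.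

Lemma gap_cost_inj (i : 'I_m.+3) : injective (cost i).
Proof.
move=> [r hr] [r' hr'] E; apply: val_inj; move: E; rewrite /cost /=.
case: i => [[|[|[|i]]] hi] /=; rewrite /left_first /right_first;
  do 2 case: ifP => ?; lia.
Qed.

Definition gap_instance : instance m.+3 :=
  cost_instance (isT : (1 < m.+3)%N) gap_cost_inj.

Lemma gap_single_peaked : single_peaked gap_instance.
Proof.
exists (fun r r' : 'I_m.+3 => (r < r')%N).
  split=> [r|r' r r''|r r' neq]; [exact: ltnn | exact: ltn_trans |].
  by rewrite -neq_ltn.
move=> i t r r' top.
(* A top other than the resource of cost 0 would have to cost less than 0. *)
have peak p : gap_cost m i p = 0%N -> (p < m.+3)%N -> t = p :> nat.
  move=> p0 hp; apply/eqP; apply: contraT => neq.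
  by have := top (Ordinal hp); rewrite /= /cost /= p0 eq_sym => /(_ neq).
move: {top} peak => /= peak sp; rewrite /cost; move: sp peak.
case: i => [[|[|[|i]]] hi] /= + peak.
- by rewrite (peak 2%N) // /right_first; do 2 case: ifP => ?; lia.
- by rewrite (peak 2%N) // /left_first; do 2 case: ifP => ?; lia.
- by rewrite (peak 1%N) // /left_first; do 2 case: ifP => ?; lia.
- rewrite (peak i.+3) //; last by rewrite /left_first leqnn subnn.
  by rewrite /left_first; do 2 case: ifP => ?; lia.
Qed.

Let a0 : 'I_m.+3 := @Ordinal m.+3 0 isT.
Let a1 : 'I_m.+3 := @Ordinal m.+3 1 isT.
Let a2 : 'I_m.+3 := @Ordinal m.+3 2 isT.

Definition good_deal : deal m.+3 := exist _ (a0, a2) isT.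
Definition bad_deal : deal m.+3 := exist _ (a1, a2) isT.

Lemma good_deal_improving : improving gap_instance 1 good_deal.
Proof. by rewrite /improving /= !perm1 /cost. Qed.

Lemma bad_deal_improving : improving gap_instance 1 bad_deal.
Proof. by rewrite /improving /= !perm1 /cost. Qed.

Let good := swap 1 good_deal.
Let bad := swap 1 bad_deal.

Lemma goodE (i : 'I_m.+3) :
  good i = (match i : nat with 0 => 2 | 2 => 0 | k => k end)%N :> nat.
Proof.
rewrite /good /swap mulg1 /=.
case: tpermP => [->|->|] //; case: i => [[|[|[|i]]] hi] //= h1 h2.
  by case: h1; apply: val_inj.
by case: h2; apply: val_inj.
Qed.

Lemma badE (i : 'I_m.+3) :
  bad i = (match i : nat with 1 => 2 | 2 => 1 | k => k end)%N :> nat.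
Proof.
rewrite /bad /swap mulg1 /=.
case: tpermP => [->|->|] //; case: i => [[|[|[|i]]] hi] //= h1 h2.
  by case: h1; apply: val_inj.
by case: h2; apply: val_inj.
Qed.

Lemma left_first_peak t : left_first t t = 0%N.
Proof. by rewrite /left_first leqnn subnn. Qed.

Lemma cost_good (i : 'I_m.+3) :
  cost i (good i) = ((i == a1) || (i == a2)) :> nat.
Proof.
rewrite /cost goodE -!val_eqE /=.
by case: i => [[|[|[|i]]] hi] //=; rewrite left_first_peak.
Qed.

Lemma cost_bad (i : 'I_m.+3) : i != a0 -> cost i (bad i) = 0%N.
Proof.
rewrite /cost badE -val_eqE /=.
by case: i => [[|[|[|i]]] hi] //=; rewrite left_first_peak.
Qed.

(** Only agents 1 and 2 lack their first choice, and agent 1 would not trade resource 1 for resource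
    0. *)
Lemma good_stable : stable gap_instance good.
Proof.
move=> d.
case: (boolP (((val d).1 \in [:: a1; a2]) && ((val d).2 \in [:: a1; a2]))).
  case: d => [[x y] /= xy]; rewrite !inE /improving /= /cost !goodE.
  by move=> /andP[/orP[]/eqP ? /orP[]/eqP ?]; subst.
rewrite negb_and => notin; apply: not_improving_cost.
by move: notin; rewrite -/cost !cost_good !eqb0 !inE.
Qed.

(** Every deal involves an agent other than 0, and such an agent holds a first choice. *)
Lemma bad_stable : stable gap_instance bad.
Proof.
move=> d; apply: not_improving_cost.
case: (eqVneq (val d).1 a0) => [e|/cost_bad ->]; last by [].
by rewrite (cost_bad (i := (val d).2)) ?orbT // -e eq_sym (valP d).
Qed.

Lemma mrk_good : (m.+2 <= mrk gap_instance good)%N.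
Proof.
apply: leq_mrk => // i; apply: leq_trans (rank_cost _ _ _ _).
by rewrite -/cost cost_good; case: (_ || _); lia.
Qed.

Lemma mrk_bad : (mrk gap_instance bad <= 1)%N.
Proof.
(* Agent 0 still holds resource 0, whose cost [m.+2] is maximal. *)
have -> : 1%N = rank gap_instance a0 (bad a0).
  rewrite /rank eq_card0 // => r; rewrite !inE /= /cost badE /=.
  apply/negbTE; rewrite -leqNgt /right_first; case: r => r hr /=.
  by case: leqP; lia.
exact: mrk_leq_rank.
Qed.

Lemma gap_ratio (R : realType) : exists M M' : dynamics R,
  [/\ M2 M, M2 M' &
      m.+2%:R <= (best_mrk M' gap_instance)%:R
                 / (worst_mrk M gap_instance)%:R :> R].
Proof.
pose open (d : deal m.+3) := @opening (val d).1 (val d).2.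
pose M d : dynamics R := deterministic R (round_robin (open d)).
have MM d : M2 (M d).
  by apply: deterministic_M2 => n I; exact: round_robin_covers.
have out d : improving gap_instance 1 d -> stable gap_instance (swap 1 d) ->
    swap 1 d \in outcomes (M d) gap_instance.
  move=> imp stab; apply: deterministic_outcomes.
  have := @round_robin_returns (open d) _ gap_instance.
  by rewrite /open openingE; apply.
exists (M bad_deal), (M good_deal); split => //.
(* One returned allocation suffices to bound the minimum from above, and likewise the maximum from
   below. *)
have -> : worst_mrk (M bad_deal) gap_instance = 1%N.
  apply/eqP; rewrite eqn_leq worst_mrk_gt0 andbT.
  apply: leq_trans mrk_bad; apply: bigminn_leq; first exact: mem_index_enum.
  by apply: out; [exact: bad_deal_improving | exact: bad_stable].
rewrite divr1 ler_nat; apply: leq_trans mrk_good _.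
apply: leq_bigmax_cond.
by apply: out; [exact: good_deal_improving | exact: good_stable].
Qed.

End Gap.

(** * Bounds on the price of dynamics *)

Lemma PoD_bounds (R : realType) (m : nat) :
  m.+2%:R <= PoD_mrk_M2 R m.+3 <= m.+3%:R.
Proof.
have [M [M' [HM HM' le]]] := gap_ratio m R.
have ub : ubound [set q : R | exists (I : instance m.+3) (M M' : dynamics R),
    [/\ single_peaked I, M2 M, M2 M' &
        q = (best_mrk M' I)%:R / (worst_mrk M I)%:R]] m.+3%:R.
  by move=> _ [I [N [N' [_ _ _ ->]]]]; exact: ratio_leq.
apply/andP; split.
  apply: le_trans le _; apply: ub_le_sup; first by eexists; exact: ub.
  by exists (gap_instance m), M, M'; split=> //; exact: gap_single_peaked.
(* An upper bound controls [sup] only for a nonempty set; the gap instance is again the witness. *)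
apply: ge_sup ub; eexists; exists (gap_instance m), M, M'.
by split=> //; exact: gap_single_peaked.
Qed.

Theorem proposition10 (R : realType) :
  (PoD_mrk_M2 R : nat -> R^o) \is 'Theta_\oo (fun n : nat => n%:R : R^o).
Proof.
(* The lower constant comes from [n - 1 >= n / 2], the upper one from ratios being at most [n]. *)
rewrite qualifE; apply/asboolP; exists (2^-1, 1) => /=.
  by rewrite invr_gt0 ltr0n ltr01.
exists 3%N => //= -[|[|[|m]]] // _.
have /andP[lo up] := PoD_bounds R m.
have PoD_ge0 : 0 <= PoD_mrk_M2 R m.+3 by apply: le_trans lo.
rewrite normr_nat (ger0_norm PoD_ge0) mul1r; split=> //.
apply: le_trans lo; rewrite mulrC ler_pdivrMr ?ltr0n // -natrM ler_nat; lia.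
Qed.
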